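(* Let $|q|<1$ and let $k\geq 4$ be an integer. Then \[ \sum_{m_1,\dots,m_{k-2}\geq 0} \frac{q^{m_1^2+\cdots+m_{k-3}^2+m_{k-3}m_{k-2}}}{(q)_{2m_1}} \Bigl(\prod_{j=2}^{k-3}\begin{bmatrix}m_{j-1}+m_j-m_{j+1}\\ 2m_j\end{bmatrix}\Bigr) \begin{bmatrix}m_{k-3}\\ m_{k-2}\end{bmatrix} =\frac{(q^{F_kF_{k-1}-1},q^{F_kF_{k-1}},q^{2F_kF_{k-1}-1};q^{2F_kF_{k-1}-1})_{\infty}}{(q;q)_{\infty}}. \]
   Context: $F_k$ denotes the Fibonacci numbers: $F_0=0$, $F_1=1$, $F_k=F_{k-1}+F_{k-2}$. $(x;q)_n=\prod_{i=0}^{n-1}(1-xq^i)$ (with $n=\infty$ allowed), $(q)_n=(q;q)_n$, and $(x_1,\dots,x_r;q)_\infty=\prod_{i=1}^r(x_i;q)_\infty$. The $q$-binomial coefficient is $\begin{bmatrix}n\\ m\end{bmatrix}=\frac{(q)_n}{(q)_m(q)_{n-m}}$ if $m$ and $n-m$ are nonnegative integers and $0$ otherwise. An empty product equals $1$. *)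

(* Defs.v *)
From HB Require Import structures.
From mathcomp Require Import all_boot all_order all_algebra.
From mathcomp Require Import complex.
From mathcomp Require Import all_classical all_reals all_analysis.
Set Implicit Arguments. Unset Strict Implicit. Unset Printing Implicit Defensive.
Import Order.TTheory GRing.Theory Num.Theory.
Import numFieldNormedType.Exports.
Local Open Scope ring_scope.
Local Open Scope classical_set_scope.

HB.instance Definition _ (R : realType) := NormedModule.copy R[i] R[i]^o.

Fixpoint fib (k : nat) : nat :=
  match k with
  | 0 => 0%N
  | 1 => 1%N
  | (j.+1 as k1).+1 => (fib k1 + fib j)%N
  end.

Section QDefs.
Variable C : comUnitRingType.

Definition qpoch (x q : C) (n : nat) : C := \prod_(i < n) (1 - x * q ^+ i).

Definition qfac (q : C) (n : nat) : C := qpoch q q n.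

Definition qbinom (q : C) (n m : int) : C :=
  if (0 <= m) && (m <= n)
  then qfac q `|n|%N / (qfac q `|m|%N * qfac q `|n - m|%N)
  else 0.
End QDefs.

Definition qpoch_inf (R : realType) (x q : R[i]) : R[i] :=
  lim ((fun n => qpoch x q n) @ \oo).

(* Reading a (k-2)-tuple as (m_1, ..., m_{k-2}) with 1-based indices. *)
Definition mof (n N : nat) (t : n.-tuple 'I_N) : nat -> nat :=
  fun i => nth 0%N (map val t) i.-1.

Definition lhs_term (R : realType) (q : R[i]) (k : nat) (m : nat -> nat) : R[i] :=
  q ^+ ((\sum_(1 <= i < k - 2) (m i) ^ 2) + m (k - 3)%N * m (k - 2)%N)%N
  / qfac q (2 * m 1%N)%N
  * (\prod_(2 <= j < k - 2)
        qbinom q ((m j.-1)%:Z + (m j)%:Z - (m j.+1)%:Z) (2 * m j)%N%:Z)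
  * qbinom q (m (k - 3)%N)%:Z (m (k - 2)%N)%:Z.

Definition lhs_partial (R : realType) (q : R[i]) (k N : nat) : R[i] :=
  \sum_(t : (k - 2).-tuple 'I_N) lhs_term q k (mof t).

Definition rhs (R : realType) (q : R[i]) (k : nat) : R[i] :=
  let L := (fib k * fib k.-1)%N in
  qpoch_inf (q ^+ L.-1) (q ^+ (2 * L).-1)
  * qpoch_inf (q ^+ L) (q ^+ (2 * L).-1)
  * qpoch_inf (q ^+ (2 * L).-1) (q ^+ (2 * L).-1)
  / qpoch_inf q q.

(* Main.v *)
(* With (q)_n^-1 read as 0 for n < 0, put
     B(L, M, a, b) = [L + M + a - b; L + a] [L + M - a + b; L - a].
   The q-Pfaff-Saalschuetz sum gives Burge's transformation
     sum_i q^(i^2) [2 L + M - i; 2 L] B(i, L - i, a, b) = q^(a^2) B(L, M, a + b, a)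
   for a, b of equal sign: it acts on (a, b) by the Fibonacci recursion. The innermost
   sum of the theorem is produced from
     sum_r (-1)^r q^(r (r + 1) / 2) B(L, M, r, r) = q^(L M) [L + M; L],
   so after all transformations (a, b) has become (F_{k-1} r, F_{k-2} r). Each summation,
   the one over m_1 included, adds r^2 times the square of a Fibonacci number to the
   exponent, in total F_2^2 + ... + F_{k-1}^2 = F_k F_{k-1} - 1 times r^2. In the limit
   L, M -> oo the multisum equals (q)_oo^-1 times
   sum_r (-1)^r q^((F_k F_{k-1} - 1) r^2 + r (r + 1) / 2), and Jacobi's triple product
   turns this into the right-hand side. The case q = 0 is treated separately, since
   negative powers of q are used. *)
Require Import Defs.
From HB Require Import structures.
From mathcomp Require Import all_boot all_order all_algebra.
From mathcomp Require Import complex.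
From mathcomp Require Import all_classical all_reals all_analysis.
From mathcomp Require Import ring zify.
Import Order.TTheory GRing.Theory Num.Theory.
Import numFieldNormedType.Exports.
Local Open Scope ring_scope.
Local Open Scope classical_set_scope.
Set Implicit Arguments. Unset Strict Implicit. Unset Printing Implicit Defensive.

(** * Bilateral sums *)

Section SymmetricSum.
Variable V : zmodType.
Implicit Types (f g : int -> V) (N : nat).

(* The sum of [f r] over [- N <= r < N]. *)
Definition bsum N f : V := \sum_(0 <= i < N) (f (Posz i) + f (Negz i)).

Lemma bsum0 f : bsum 0 f = 0.
Proof. by rewrite /bsum big_geq. Qed.

Lemma bsumS N f : bsum N.+1 f = bsum N f + (f N + f (Negz N)).
Proof. by rewrite /bsum big_nat_recr. Qed.

Lemma eq_bsum N f g : f =1 g -> bsum N f = bsum N g.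
Proof. by move=> fg; apply: eq_bigr => i _; rewrite !fg. Qed.

Lemma bsumB N f g : bsum N (fun r => f r - g r) = bsum N f - bsum N g.
Proof. by rewrite /bsum -sumrB; apply: eq_bigr => i _; rewrite opprD addrACA. Qed.

Lemma bsumD N f g : bsum N (fun r => f r + g r) = bsum N f + bsum N g.
Proof. by rewrite /bsum -big_split; apply: eq_bigr => i _ /=; rewrite addrACA. Qed.

Lemma bsum_shift N f :
  bsum N (fun r => f (r + 1)) = bsum N f + f N - f (- N%:Z).
Proof.
elim: N => [|N IHN]; first by rewrite !bsum0 add0r subrr.
rewrite !bsumS IHN NegzE.
have -> : N%:Z + 1 = N.+1%:Z by lia.
have -> : - N.+1%:Z + 1 = - N%:Z by lia.
move: (f (Posz N.+1)) (f (- N.+1%:Z)) (f N) (f (- N%:Z)) => a b c d.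
by rewrite -!addrA; congr (_ + (_ + _)); rewrite [- d + _]addrCA addNr [b + _]addrCA subrr.
Qed.

Lemma bsum_opp N f :
  bsum N (fun r => f (- r)) = bsum N f + f N - f (- N%:Z).
Proof.
elim: N => [|N IHN]; first by rewrite !bsum0 add0r subrr.
rewrite !bsumS IHN NegzE opprK.
move: (f (Posz N.+1)) (f (- N.+1%:Z)) (f N) (f (- N%:Z)) => a b c d.
by rewrite -!addrA; congr (_ + (_ + _)); rewrite addKr addrCA subrr addr0.
Qed.

Lemma bsum_telescope N f :
  bsum N (fun r => f (r + 1) - f r) = f N - f (- N%:Z).
Proof. by rewrite bsumB bsum_shift addrC -addrA addKr. Qed.

Lemma exchange_bsum N (I : Type) (s : seq I) (F : I -> int -> V) :
  \sum_(i <- s) bsum N (F i) = bsum N (fun r => \sum_(i <- s) F i r).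
Proof. by rewrite exchange_big; apply: eq_bigr => j _ /=; rewrite big_split. Qed.

End SymmetricSum.

Lemma mulr_bsumr (A : pzRingType) N (x : A) (f : int -> A) :
  x * bsum N f = bsum N (fun r => x * f r).
Proof. by rewrite mulr_sumr; apply: eq_bigr => i _; rewrite mulrDr. Qed.

Lemma mulr_bsuml (A : pzRingType) N (x : A) (f : int -> A) :
  bsum N f * x = bsum N (fun r => f r * x).
Proof. by rewrite mulr_suml; apply: eq_bigr => i _; rewrite mulrDl. Qed.

(** * Burge's transformation *)

Section QCalculus.
Variables (C : fieldType) (q : C).
Hypothesis (q_nroot : forall n : nat, 1 - q ^+ n.+1 != 0).

(** The value at negative [n] is junk; in [qbinomE] and [qbinom2] it always meets a vanishing
    [rqfac]. *)
Definition qfacz (n : int) : C := qfac q `|n|%N.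

(* Extending 1/(q)_n by 0 to negative n makes all summation ranges natural. *)
Definition rqfac (n : int) : C := if n is Posz m then (qfac q m)^-1 else 0.
Arguments rqfac : simpl never.

Lemma qfacS (n : nat) : qfac q n.+1 = qfac q n * (1 - q ^+ n.+1).
Proof. by rewrite /qfac /qpoch big_ord_recr /= exprS. Qed.

Lemma qfac_neq0 (n : nat) : qfac q n != 0.
Proof.
elim: n => [|n IHn]; first by rewrite /qfac /qpoch big_ord0 oner_eq0.
by rewrite qfacS mulf_neq0.
Qed.

Lemma rqfac_lt0 (n : int) : n < 0 -> rqfac n = 0.
Proof. by case: n. Qed.

Lemma rqfac0 : rqfac 0 = 1.
Proof. by rewrite /rqfac /= /qfac /qpoch big_ord0 invr1. Qed.

Lemma qfaczK (n : int) : 0 <= n -> qfacz n * rqfac n = 1.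
Proof. by case: n => // n _; rewrite /qfacz /= mulfV ?qfac_neq0. Qed.

Lemma qfacz_pred (m n : int) : m + 1 = n -> 0 < n -> qfacz n = (1 - q ^ n) * qfacz m.
Proof.
move=> <- {n}; case: m => [m _|m]; last by rewrite NegzE; lia.
by rewrite -PoszD addn1 /qfacz /= qfacS -exprnP mulrC.
Qed.

(** At [n = 0] the factor [1 - q ^ 0] vanishes, so the recurrence holds for every integer and the
    certificates below have no boundary cases. *)
Lemma rqfac_pred (m n : int) : m + 1 = n -> rqfac m = (1 - q ^ n) * rqfac n.
Proof.
move=> <- {n}; case: m => [m|[|m]].
- rewrite -PoszD addn1 /rqfac qfacS -exprnP invfM mulrCA mulrA -mulrA mulfV ?mulr1 //.
- by rewrite (_ : Negz 0 + 1 = 0) // expr0z subrr mul0r.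
- by rewrite (_ : Negz m.+1 + 1 = Negz m) ?mulr0 //; lia.
Qed.

Lemma exprz_neq1 (n : int) : 0 < n -> 1 - q ^ n != 0.
Proof. by case: n => [[|n]|n] // _; exact: q_nroot. Qed.

Lemma qbinomE (n m : int) : qbinom q n m = qfacz n * rqfac m * rqfac (n - m).
Proof.
rewrite /qbinom; case: (boolP (_ && _)) => [/andP[m0 mn]|].
  have : 0 <= n - m by lia.
  case: (n - m) => // k _; case: m m0 {mn} => // m _.
  by rewrite /qfacz /= invfM mulrA.
rewrite negb_and => /orP[] h.
  by rewrite (@rqfac_lt0 m) ?mulr0 ?mul0r //; lia.
by rewrite (@rqfac_lt0 (n - m)) ?mulr0 //; lia.
Qed.

(* The product [L + M + a - b; L + a] [L + M - a + b; L - a]. *)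
Definition qbinom2 (L M a b : int) : C :=
  qfacz (L + M + a - b) * qfacz (L + M - a + b)
  * (rqfac (L + a) * rqfac (L - a) * (rqfac (M - b) * rqfac (M + b))).

Lemma qbinom2N (L M a b : int) : qbinom2 L M (- a) (- b) = qbinom2 L M a b.
Proof. rewrite /qbinom2 !opprK; ring. Qed.

Hypothesis q_neq0 : q != 0.

Section Burge.
Variables (L a b : nat).

Let tail (i : nat) : C :=
  rqfac (i%:Z + a%:Z) * rqfac (i%:Z - a%:Z)
  * rqfac (L%:Z - i%:Z - b%:Z) * rqfac (L%:Z - i%:Z + b%:Z).

Let S (M : nat) : C :=
  \sum_(0 <= i < L.+1) q ^+ (i ^ 2)
    * (qfacz ((2 * L)%N%:Z + M%:Z - i%:Z) * rqfac (M%:Z - i%:Z) * tail i).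

(* A Wilf-Zeilberger certificate for the q-Pfaff-Saalschuetz sum. *)
Let cert (M i : nat) : C :=
  - q ^ (M.+1%:Z - i%:Z) * q ^+ (i ^ 2)
  * (qfacz ((2 * L)%N%:Z + M.+1%:Z - i%:Z) * rqfac (M.+1%:Z - i%:Z)
    * (rqfac (i%:Z + a%:Z - 1) * rqfac (i%:Z - a%:Z - 1)
       * rqfac (L%:Z - i%:Z - b%:Z) * rqfac (L%:Z - i%:Z + b%:Z))).

(** Once all factorials are expressed through the same six, this is a rational identity in [q] and
    its powers, which [field] decides. *)
Lemma burge_certificate (M i : nat) : (i <= L)%N ->
  (1 - q ^ (M.+1%:Z - a%:Z)) * (1 - q ^ (M.+1%:Z + a%:Z))
    * (q ^+ (i ^ 2) * (qfacz ((2 * L)%N%:Z + M.+1%:Z - i%:Z)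
       * rqfac (M.+1%:Z - i%:Z) * tail i))
  - (1 - q ^ (L%:Z + M.+1%:Z + b%:Z)) * (1 - q ^ (L%:Z + M.+1%:Z - b%:Z))
    * (q ^+ (i ^ 2) * (qfacz ((2 * L)%N%:Z + M%:Z - i%:Z)
       * rqfac (M%:Z - i%:Z) * tail i))
  = cert M i.+1 - cert M i.
Proof.
move=> iL; rewrite /cert /tail.
rewrite (@qfacz_pred ((2 * L)%N%:Z + M%:Z - i%:Z)
                     ((2 * L)%N%:Z + M.+1%:Z - i%:Z)); [|lia..].
rewrite (_ : (2 * L)%N%:Z + M.+1%:Z - i.+1%:Z = (2 * L)%N%:Z + M%:Z - i%:Z); last lia.
rewrite (_ : M.+1%:Z - i.+1%:Z = M%:Z - i%:Z); last lia.
rewrite (@rqfac_pred (M%:Z - i%:Z) (M.+1%:Z - i%:Z)); last lia.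
rewrite (_ : i.+1%:Z + a%:Z - 1 = i%:Z + a%:Z); last lia.
rewrite (_ : i.+1%:Z - a%:Z - 1 = i%:Z - a%:Z); last lia.
rewrite (@rqfac_pred (i%:Z + a%:Z - 1) (i%:Z + a%:Z)); last lia.
rewrite (@rqfac_pred (i%:Z - a%:Z - 1) (i%:Z - a%:Z)); last lia.
rewrite (@rqfac_pred (L%:Z - i.+1%:Z - b%:Z) (L%:Z - i%:Z - b%:Z)); last lia.
rewrite (@rqfac_pred (L%:Z - i.+1%:Z + b%:Z) (L%:Z - i%:Z + b%:Z)); last lia.
move: (qfacz _) (rqfac (M.+1%:Z - i%:Z)) (rqfac (i%:Z + a%:Z)) (rqfac (i%:Z - a%:Z))
  (rqfac (L%:Z - i%:Z - b%:Z)) (rqfac (L%:Z - i%:Z + b%:Z)) => y1 y2 y3 y4 y5 y6.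
have -> : q ^+ (i.+1 ^ 2) = q ^+ (i ^ 2) * (q ^ i%:Z) ^+ 2 * q.
  by rewrite -exprnP -exprM -exprD -exprSr; congr (_ ^+ _); nia.
have -> : q ^ ((2 * L)%N%:Z + M.+1%:Z - i%:Z)
    = (q ^ L%:Z) ^+ 2 * (q ^ M%:Z * q) / q ^ i%:Z.
  rewrite !expfzDr // -invr_expz -!exprnP mulnC exprM; congr (_ * _ / _).
  by rewrite exprSr.
have M1 : q ^ M.+1%:Z = q ^ M%:Z * q by rewrite -!exprnP exprSr.
rewrite !expfzDr // -!invr_expz M1.
have := expfz_neq0 i%:Z q_neq0; have := expfz_neq0 b%:Z q_neq0.
have := expfz_neq0 a%:Z q_neq0.
move: (q ^ i%:Z) (q ^ L%:Z) (q ^ M%:Z) (q ^ a%:Z) (q ^ b%:Z) (q ^+ _)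
  => x l m A B z An Bn xn.
by field; rewrite An Bn xn.
Qed.

(** Summing the certificate over [0 <= i <= L] telescopes; [1/(q)_(L-i-b)] vanishes at [i = L + 1],
    and [1/(q)_(i-a-1)] at [i = 0]. *)
Lemma burge_rec (M : nat) :
  (1 - q ^ (M.+1%:Z - a%:Z)) * (1 - q ^ (M.+1%:Z + a%:Z)) * S M.+1
  = (1 - q ^ (L%:Z + M.+1%:Z + b%:Z)) * (1 - q ^ (L%:Z + M.+1%:Z - b%:Z)) * S M.
Proof.
apply/eqP; rewrite -subr_eq0 /S !mulr_sumr -sumrB.
under eq_big_nat => i /andP[_ iL] do rewrite burge_certificate //.
rewrite telescope_sumr // /cert.
rewrite (@rqfac_lt0 (L%:Z - _ - b%:Z)); last by lia.
rewrite (@rqfac_lt0 (0%:Z - _ - 1)); last by lia.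
by rewrite !(mulr0, mul0r) subr0.
Qed.


(** If [L < a + b] or [M < a], no [i] satisfies [a <= i <= min(L - b, M)] and both sides vanish.
    Otherwise induction on [M] starts at [M = a], where only [i = a] contributes; the step is
    [burge_rec], whose left-hand factors are nonzero for [M >= a]. *)
Lemma burge_sum (M : nat) :
  qfacz (L%:Z + a%:Z - b%:Z) * qfacz (L%:Z - a%:Z + b%:Z) * rqfac (2 * L)%N%:Z * S M
  = q ^+ (a ^ 2) * qbinom2 L M (a%:Z + b%:Z) a.
Proof.
have [abL|Lab] := leqP (a + b) L; last first.
  rewrite /S big1_seq ?mulr0 => [|i /= _].
    by rewrite /qbinom2 (@rqfac_lt0 (L%:Z - _)) ?(mulr0, mul0r) //; lia.
  rewrite /tail; have [ia|ai] := ltnP i a.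
    by rewrite (@rqfac_lt0 (i%:Z - a%:Z)) ?(mulr0, mul0r) //; lia.
  by rewrite (@rqfac_lt0 (L%:Z - i%:Z - b%:Z)) ?(mulr0, mul0r) //; lia.
have [Ma|] := ltnP M a.
  rewrite /S big1_seq ?mulr0 => [|i /= _].
    by rewrite /qbinom2 (@rqfac_lt0 (M%:Z - _)) ?(mulr0, mul0r) //; lia.
  rewrite /tail; have [ia|ai] := ltnP i a.
    by rewrite (@rqfac_lt0 (i%:Z - a%:Z)) ?(mulr0, mul0r) //; lia.
  by rewrite (@rqfac_lt0 (M%:Z - i%:Z)) ?(mulr0, mul0r) //; lia.
move=> /subnKC <-; elim: (M - a)%N => [|d IHd].
  rewrite addn0 /S (@big_cat_nat _ _ _ a) ?leq0n //=; last by lia.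
  rewrite big1_seq ?add0r => [|i /=]; last first.
    rewrite mem_index_iota => /andP[_ ia].
    by rewrite /tail (@rqfac_lt0 (i%:Z - a%:Z)) ?(mulr0, mul0r) //; lia.
  rewrite big_ltn; last by lia.
  rewrite big1_seq ?addr0 => [|i /=]; last first.
    rewrite mem_index_iota => /andP[ai _].
    by rewrite (@rqfac_lt0 (a%:Z - i%:Z)) ?(mulr0, mul0r) //; lia.
  rewrite /tail /qbinom2 subrr rqfac0 addrK.
  rewrite (_ : L%:Z - (a%:Z + b%:Z) = L%:Z - a%:Z - b%:Z); last by lia.
  rewrite (_ : L%:Z + a%:Z + (a%:Z + b%:Z) - a%:Z = L%:Z + (a%:Z + b%:Z)); last by lia.
  rewrite (_ : L%:Z + a%:Z - (a%:Z + b%:Z) + a%:Z = L%:Z + a%:Z - b%:Z); last by lia.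
  have h1 : qfacz (2 * L)%N * rqfac (2 * L)%N = 1 by apply: qfaczK.
  have h2 : qfacz (L%:Z - a%:Z + b%:Z) * rqfac (L%:Z - a%:Z + b%:Z) = 1.
    by apply: qfaczK; lia.
  have h3 : qfacz (L%:Z + (a%:Z + b%:Z)) * rqfac (L%:Z + (a%:Z + b%:Z)) = 1.
    by apply: qfaczK; lia.
  have e1 : qfacz (L%:Z + a%:Z - b%:Z) * q ^+ (a ^ 2) * rqfac (a%:Z + a%:Z)
    * rqfac (L%:Z - a%:Z - b%:Z) * (qfacz (2 * L)%N * rqfac (2 * L)%N)
    * (qfacz (L%:Z - a%:Z + b%:Z) * rqfac (L%:Z - a%:Z + b%:Z))
   = qfacz (L%:Z + a%:Z - b%:Z) * q ^+ (a ^ 2) * rqfac (a%:Z + a%:Z)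
    * rqfac (L%:Z - a%:Z - b%:Z)
    * (qfacz (L%:Z + (a%:Z + b%:Z)) * rqfac (L%:Z + (a%:Z + b%:Z))).
    by rewrite h1 h2 h3 !mulr1.
  move: e1; move: (qfacz _) (qfacz _) (qfacz _) (qfacz _) => y1 y2 y3 y4 e1.
  by ring: e1.
have [n1 n2] : 1 - q ^ ((a + d).+1%:Z - a%:Z) != 0 /\ 1 - q ^ ((a + d).+1%:Z + a%:Z) != 0.
  by split; apply: exprz_neq1; lia.
apply: (mulfI (mulf_neq0 n1 n2)); rewrite addnS.
rewrite mulrCA [in LHS]burge_rec mulrCA IHd.
rewrite /qbinom2.
rewrite (@rqfac_pred ((a + d)%N%:Z - a%:Z) ((a + d).+1%:Z - a%:Z)); last by lia.
rewrite (@rqfac_pred ((a + d)%N%:Z + a%:Z) ((a + d).+1%:Z + a%:Z)); last by lia.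
have e1 (c : int) : L%:Z + c + (a%:Z + b%:Z) - a%:Z = L%:Z + c + b%:Z by lia.
have e2 (c : int) : L%:Z + c - (a%:Z + b%:Z) + a%:Z = L%:Z + c - b%:Z by lia.
rewrite !e1 !e2.
rewrite (@qfacz_pred (L%:Z + (a + d)%N%:Z + b%:Z) (L%:Z + (a + d).+1%:Z + b%:Z)); [|lia..].
rewrite (@qfacz_pred (L%:Z + (a + d)%N%:Z - b%:Z) (L%:Z + (a + d).+1%:Z - b%:Z)); [|lia..].
ring.
Qed.

End Burge.

(** Terms with [i > L] vanish through [1/(q)_(L-i-b)], so any range beyond [L] gives the full sum;
    for negative [M] both sides are zero. *)
Lemma burge_transform (N L a b : nat) (M : int) : (L < N)%N ->
  \sum_(0 <= i < N) q ^+ (i ^ 2) * qbinom q ((2 * L)%N%:Z + M - i%:Z) (2 * L)%N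
    * qbinom2 i (L%:Z - i%:Z) a b
  = q ^+ (a ^ 2) * qbinom2 L M (a%:Z + b%:Z) a.
Proof.
move=> LN; rewrite (@big_cat_nat _ _ _ L.+1) //=.
rewrite [X in _ + X]big1_seq ?addr0 => [|i /=]; last first.
  rewrite mem_index_iota => /andP[Li _].
  by rewrite /qbinom2 (@rqfac_lt0 (_ - b%:Z)) ?(mulr0, mul0r) //; lia.
case: M => [M|M]; last first.
  rewrite big1_seq => [|i /= _].
    by rewrite /qbinom2 (@rqfac_lt0 (_ - a%:Z)) ?(mulr0, mul0r) //; lia.
  by rewrite qbinomE (@rqfac_lt0 (_ - (2 * L)%N%:Z)) ?(mulr0, mul0r) //; lia.
rewrite -burge_sum mulr_sumr; apply: eq_big_nat => i _.
rewrite qbinomE /qbinom2.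
rewrite (_ : (2 * L)%N%:Z + M%:Z - i%:Z - (2 * L)%N%:Z = M%:Z - i%:Z); last by lia.
rewrite (_ : i%:Z + (L%:Z - i%:Z) = L%:Z); last by lia.
ring.
Qed.

(** Joint sign reversal makes Burge's transformation, proved for [a, b >= 0], available for every
    integer multiple of such a pair. *)
Lemma qbinom2_absz (L M r : int) (a b : nat) :
  qbinom2 L M (a%:Z * r) (b%:Z * r) = qbinom2 L M (a * `|r|)%N (b * `|r|)%N.
Proof.
rewrite !PoszM; case: r => [//|n].
by rewrite NegzE !mulrN abszN /= qbinom2N.
Qed.

Lemma burge_transformz (N L a b : nat) (M r : int) : (L < N)%N ->
  \sum_(0 <= i < N) q ^+ (i ^ 2) * qbinom q ((2 * L)%N%:Z + M - i%:Z) (2 * L)%N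
    * qbinom2 i (L%:Z - i%:Z) (a%:Z * r) (b%:Z * r)
  = q ^+ (a ^ 2 * `|r| ^ 2) * qbinom2 L M ((a + b)%N%:Z * r) (a%:Z * r).
Proof.
move=> LN; under eq_bigr do rewrite qbinom2_absz.
by rewrite burge_transform // qbinom2_absz mulnDl PoszD expnMn.
Qed.

End QCalculus.

(** * Finite theta-type sums *)

(* Both cases are the triangular number [r * (r + 1) / 2]. *)
Definition triz (r : int) : nat :=
  match r with Posz n | Negz n => 'C(n.+1, 2) end.

Lemma trizS (r : int) : (triz (r + 1))%:Z = (triz r)%:Z + (r + 1).
Proof.
case: r => [n|[|n]].
- by rewrite -PoszD addn1 /triz binS bin1 PoszD addrC.
- by [].
rewrite (_ : Negz n.+1 + 1 = Negz n); last by lia.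
by rewrite /triz [in RHS]binS bin1 PoszD; lia.
Qed.

Section WeightedSums.
Variables (C : fieldType) (q : C).
Hypotheses (q_neq0 : q != 0) (q_nroot : forall n : nat, 1 - q ^+ n.+1 != 0).

(** The general term [(-1)^r q^(e r^2 + r (r + 1) / 2)] of a theta series; a natural exponent makes
    its modulus easy to bound. *)
Definition theta_coef (e : nat) (r : int) : C :=
  (-1) ^ r * q ^+ (e * `|r| ^ 2 + triz r).

Lemma theta_coefS (e : nat) (r : int) :
  theta_coef e (r + 1) = - q ^ (e%:Z * (2 * r + 1) + (r + 1)) * theta_coef e r.
Proof.
rewrite /theta_coef expfzDr ?oppr_eq0 ?oner_eq0 // expr1z !exprnP.
have -> : (e * `|(r + 1)%R| ^ 2 + triz (r + 1))%N%:Z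
    = (e%:Z * (2 * r + 1) + (r + 1)) + (e * `|r| ^ 2 + triz r)%N%:Z.
  rewrite !PoszD trizS !PoszM.
  have sq (s : int) : `|s|%N%:Z * `|s|%N%:Z = s * s by nia.
  by rewrite !sq; ring.
rewrite [in LHS]expfzDr //; ring.
Qed.

Lemma theta_coefN (r : int) : theta_coef 0 (- r) = q ^ (- r) * theta_coef 0 r.
Proof.
have H (n : nat) : theta_coef 0 (- n%:Z) = q ^ (- n%:Z) * theta_coef 0 n.
  elim: n => [|n IHn]; first by rewrite oppr0 expr0z mul1r.
  have := theta_coefS 0 (- n.+1%:Z).
  rewrite (_ : - n.+1%:Z + 1 = - n%:Z); last by lia.
  rewrite IHn (_ : n.+1%:Z = n%:Z + 1); last by lia.
  rewrite theta_coefS !mul0r !add0r opprD.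
  have nz k : - q ^ k != 0 by rewrite oppr_eq0 expfz_neq0.
  move=> e; apply: (mulfI (nz (- n%:Z))); rewrite -e.
  rewrite !expfzDr // expr1z -!invr_expz expr1z.
  have := expfz_neq0 n%:Z q_neq0; move: (q ^ n%:Z) (theta_coef _ _) => x y xn.
  by field; rewrite xn q_neq0.
case: r => [n|n]; first exact: H.
rewrite NegzE opprK H mulrA -expfzDr //.
by rewrite subrr expr0z mul1r.
Qed.

Lemma theta_coef0 (e : nat) : theta_coef e 0 = 1.
Proof. by rewrite /theta_coef expr0z muln0 mul1r. Qed.

Lemma theta_coefD (e m : nat) (r : int) :
  theta_coef e r * q ^+ (m * `|r| ^ 2) = theta_coef (e + m) r.
Proof. by rewrite /theta_coef -mulrA -exprD addnAC -mulnDl. Qed.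

Local Notation rqfac := (rqfac q).
Local Notation qfacz := (qfacz q).
Local Notation rec := (rqfac_pred q_nroot).

Let core (L M : nat) (r : int) :=
  rqfac (L%:Z - r) * rqfac (L%:Z + r) * (rqfac (M%:Z - r) * rqfac (M%:Z + r)).

(** Up to sign, the Gosper antidifference in [r] of the combination in [sym_certificate]. *)
Let cert (L M : nat) (r : int) :=
  theta_coef 0 r * q ^ (- r)
  * (rqfac (L%:Z - r) * rqfac (L%:Z + (r - 1)) * (rqfac (M%:Z - r) * rqfac (M%:Z + (r - 1)))).

(* Symmetrising under [r -> - r] makes the summand Gosper-summable. *)
Let sym (N L M : nat) := bsum N (fun r => (1 + q ^ (- r)) * theta_coef 0 r * core L M r).

(** By [theta_coefN] the weight [q ^ (- r)] turns the summand into its reflection; the boundary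
    terms at [N] and [- N] vanish since [L < N]. *)
Lemma symE (N L M : nat) : (L < N)%N ->
  sym N L M = bsum N (fun r => theta_coef 0 r * core L M r) *+ 2.
Proof.
move=> LN.
have z (F : C): F * core L M N = 0.
  by rewrite /core (@rqfac_lt0 _ _ (L%:Z - N%:Z)) ?(mulr0, mul0r) //; lia.
have zN (F : C): F * core L M (- N%:Z) = 0.
  by rewrite /core (@rqfac_lt0 _ _ (L%:Z + - N%:Z)) ?(mulr0, mul0r) //; lia.
have := bsum_opp N (fun r => theta_coef 0 r * core L M r).
rewrite z zN addr0 subr0 => e.
rewrite mulr2n -[X in _ = X + _]e -bsumD; apply: eq_bsum => r.
rewrite theta_coefN /core opprK; ring.
Qed.

Lemma sym_certificate (L M : nat) (r : int) :
  (1 - q ^ (L%:Z + M.+1%:Z)) * (1 - q ^ (M.+1%:Z)) *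
     ((1 + q ^ (- r)) * theta_coef 0 r * core L M.+1 r)
  - q ^ L%:Z * ((1 + q ^ (- r)) * theta_coef 0 r * core L M r)
  = - (cert L M.+1 (r + 1) - cert L M.+1 r).
Proof.
rewrite /cert /core theta_coefS mul0r add0r.
rewrite (@rec (M%:Z - r) (M.+1%:Z - r)); last lia.
rewrite (@rec (M%:Z + r) (M.+1%:Z + r)); last lia.
rewrite (@rec (M.+1%:Z - (r + 1)) (M.+1%:Z - r)); last lia.
rewrite (@rec (M.+1%:Z + (r - 1)) (M.+1%:Z + r)); last lia.
rewrite (@rec (L%:Z - (r + 1)) (L%:Z - r)); last lia.
rewrite (@rec (L%:Z + (r - 1)) (L%:Z + r)); last lia.
rewrite addrK.
move: (rqfac (L%:Z - r)) (rqfac (L%:Z + r)) (rqfac (M.+1%:Z - r)) (rqfac (M.+1%:Z + r))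
  (theta_coef 0 r) => y1 y2 y3 y4 y5.
rewrite -!invr_expz !expfzDr // -!invr_expz expr1z.
have := expfz_neq0 r q_neq0; move: (q ^ r) (q ^ L%:Z) (q ^ M.+1%:Z) => x l m xn.
by field; rewrite xn q_neq0.
Qed.

Lemma sym_rec (N L M : nat) : (L < N)%N ->
  (1 - q ^ (L%:Z + M.+1%:Z)) * (1 - q ^ (M.+1%:Z)) * sym N L M.+1 = q ^ L%:Z * sym N L M.
Proof.
move=> LN; apply/eqP; rewrite -subr_eq0 /sym !mulr_bsumr -bsumB.
under eq_bsum do rewrite sym_certificate -mulN1r.
rewrite -mulr_bsumr bsum_telescope /cert.
rewrite (@rqfac_lt0 _ _ (L%:Z - N%:Z)); last by lia.
rewrite (@rqfac_lt0 _ _ (L%:Z + (- N%:Z - 1))); last by lia.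
by rewrite !(mulr0, mul0r) subr0 mulr0.
Qed.

(** Induction on [M]: at [M = 0] only [r = 0] survives, and each use of [sym_rec] contributes
    [q ^ L] and one new factor to [(q)_(L+M)] and to [(q)_M]. *)
Lemma sym_closed (N L M : nat) : (L < N)%N ->
  sym N L M = (q ^ (L%:Z * M%:Z) * rqfac (L%:Z + M%:Z) * rqfac L * rqfac M) *+ 2.
Proof.
move=> LN; elim: M => [|M IHM].
  rewrite mulr0 expr0z addr0 mul1r symE //; congr (_ *+ 2).
  rewrite /bsum big_ltn ?big1_seq ?addr0; last by lia.
    rewrite theta_coef0 /core subr0 addr0 rqfac0.
    by rewrite !mulr1 mul1r (@rqfac_lt0 _ _ (0%:Z + Negz 0)) // !mulr0 addr0.
  move=> i /=; rewrite mem_index_iota => /andP[i0 _].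
  rewrite /core (@rqfac_lt0 _ _ (0%:Z - i%:Z)); last by lia.
  by rewrite (@rqfac_lt0 _ _ (0%:Z + Negz i)) ?(mulr0, mul0r, addr0) //; lia.
have n1 : (1 - q ^ (L%:Z + M.+1%:Z)) * (1 - q ^ (M.+1%:Z)) != 0.
  by rewrite mulf_neq0 // exprz_neq1 //; lia.
apply: (mulfI n1); rewrite sym_rec // IHM.
rewrite (@rec (L%:Z + M%:Z) (L%:Z + M.+1%:Z)); last by lia.
rewrite (@rec M%:Z M.+1%:Z); last by lia.
rewrite (_ : L%:Z * M.+1%:Z = L%:Z + L%:Z * M%:Z); last by lia.
rewrite [q ^ (L%:Z + L%:Z * _)]expfzDr //; ring.
Qed.

(** This evaluates the innermost sum: [two_neq0] undoes the doubling by symmetrisation, and the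
    factor [(q)_(L+M)^2], free of [r], is restored. *)
Lemma theta_qbinom2 (N L : nat) (M : int) : (2 : C) != 0 -> (L < N)%N ->
  bsum N (fun r => theta_coef 0 r * qbinom2 q L M r r)
  = q ^ (L%:Z * M) * qbinom q (L%:Z + M) L.
Proof.
move=> two_neq0 LN; rewrite qbinomE (_ : L%:Z + M - L%:Z = M); last by lia.
case: M => [M|M]; last first.
  rewrite [rqfac (Negz M)]rqfac_lt0 // mulr0 mulr0.
  rewrite /bsum big1_seq // => i _ /=; rewrite /qbinom2.
  rewrite (@rqfac_lt0 _ _ (Negz M - i%:Z)); last by lia.
  by rewrite (@rqfac_lt0 _ _ (Negz M + Negz i)) ?(mulr0, mul0r, addr0) //; lia.
have -> : bsum N (fun r => theta_coef 0 r * qbinom2 q L M r r)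
    = qfacz (L%:Z + M%:Z) ^+ 2 * bsum N (fun r => theta_coef 0 r * core L M r).
  rewrite mulr_bsumr; apply: eq_bsum => r.
  rewrite /qbinom2 /core addrK subrK; ring.
have := sym_closed M LN; rewrite symE // => e.
rewrite (mulfI two_neq0 (etrans (mulr_natl _ 2) (etrans e (esym (mulr_natl _ 2))))).
have := qfaczK q_nroot (isT : 0 <= L%:Z + M%:Z).
move: (qfacz _) (rqfac (_ + _)) => u v uv.
by ring: uv.
Qed.
End WeightedSums.

(** * Finite form of Jacobi's triple product *)

Section FiniteJacobi.
Variables (C : fieldType) (q z : C) (W : int -> C).
Hypotheses (q_neq0 : q != 0) (q_nroot : forall n : nat, 1 - q ^+ n.+1 != 0).
Hypotheses (z_neq0 : z != 0) (W0 : W 0 = 1).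
(** With [W0] this forces [W r = (-1)^r z^r q^(r (r - 1) / 2)]. Working from the recurrence lets a
    theta coefficient in another base be substituted directly. *)
Hypothesis WS : forall r : int, W (r + 1) = - (z * q ^ r) * W r.

Local Notation rqfac := (rqfac q).
Local Notation qfacz := (qfacz q).
Local Notation rec := (rqfac_pred q_nroot).

Let h (N M : nat) (r : int) := W r * (rqfac (M%:Z + r) * rqfac (N%:Z - r)).

Let h_ge (N M K : nat) : (N < K)%N -> h N M K = 0.
Proof. by move=> NK; rewrite /h (@rqfac_lt0 _ _ (N%:Z - _)) ?mulr0 //; lia. Qed.

Let h_le (N M K : nat) : (M < K)%N -> h N M (- K%:Z) = 0.
Proof. by move=> MK; rewrite /h (@rqfac_lt0 _ _ (M%:Z + _)) ?(mulr0, mul0r) //; lia. Qed.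

Let h_shift (N M K : nat) : (N < K)%N -> (M < K)%N ->
  bsum K (fun r => h N M (r + 1)) = bsum K (h N M).
Proof. by move=> NK MK; rewrite bsum_shift h_ge // h_le // addr0 subr0. Qed.

(** A q-Pascal rule: summed over all [r], the right-hand side is [1 - z q^N] times the sum for [N],
    which gives the next factor of [(z; q)_(N+1)]. *)
Let h_stepN (N M : nat) (r : int) :
  (1 - q ^ (N + M).+1%:Z) * h N.+1 M (r + 1) = h N M (r + 1) - z * q ^ N%:Z * h N M r.
Proof.
rewrite /h (@rec (N%:Z - (r + 1)) (N.+1%:Z - (r + 1))); last lia.
rewrite (@rec (M%:Z + r) (M%:Z + (r + 1))); last lia.
rewrite (_ : N.+1%:Z - (r + 1) = N%:Z - r); last lia.
rewrite (_ : (N + M).+1%:Z = N%:Z + M%:Z + 1); last lia.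
rewrite WS !expfzDr // -!invr_expz expr1z.
have := expfz_neq0 r q_neq0.
move: (W r) (rqfac _) (rqfac _) (q ^ r) (q ^ N) (q ^ M) => y1 y2 y3 x n m xn.
by field.
Qed.

(** The companion rule in [M] produces the factor [1 - (q / z) q^M]. *)
Let h_stepM (N M : nat) (r : int) :
  (1 - q ^ (N + M).+1%:Z) * h N M.+1 r = h N M r - q ^ M.+1%:Z / z * h N M (r + 1).
Proof.
rewrite /h (@rec (N%:Z - (r + 1)) (N%:Z - r)); last lia.
rewrite (@rec (M%:Z + r) (M.+1%:Z + r)); last lia.
rewrite (_ : M%:Z + (r + 1) = M.+1%:Z + r); last lia.
rewrite (_ : (N + M).+1%:Z = N%:Z + M.+1%:Z); last lia.
rewrite WS !expfzDr // -!invr_expz.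
have := expfz_neq0 r q_neq0.
move: (W r) (rqfac _) (rqfac _) (q ^ r) (q ^ N) (q ^ M.+1) => y1 y2 y3 x n m xn.
by field; rewrite xn z_neq0.
Qed.

(** The window [K] covers the support [- M <= r <= N], so the sum is invariant under shifts of [r]
    and the two rules apply: induction on [M], then on [N] at [M = 0]. *)
Lemma finite_jacobi (N M K : nat) : (N < K)%N -> (M < K)%N ->
  qfac q (N + M) * bsum K (fun r => W r * (rqfac (M%:Z + r) * rqfac (N%:Z - r)))
  = qpoch z q N * qpoch (q / z) q M.
Proof.
rewrite -/(h N M); elim: M => [|M IHM] NK MK; last first.
  rewrite addnS qfacS -mulrA exprnP mulr_bsumr.
  under eq_bsum do rewrite h_stepM.
  rewrite bsumB -mulr_bsumr h_shift //; last by lia.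
  rewrite /qpoch [in X in _ = _ * X]big_ord_recr /= -/(qpoch _ _ _).
  rewrite mulrA -IHM //; last by lia.
  rewrite -exprnP exprS; ring.
rewrite addn0 [qpoch _ _ 0]/qpoch big_ord0 mulr1.
elim: N NK => [|N IHN] NK.
  rewrite [qpoch _ _ _]/qpoch big_ord0 /qfac /qpoch big_ord0 mul1r /bsum big_ltn //.
  rewrite /h addr0 ?subr0 W0 rqfac0 (@rqfac_lt0 _ _ (0%:Z + Negz 0)) //.
  rewrite !mul0r mulr0 addr0 !mulr1 big1_seq ?addr0 // => i /andP[_].
  rewrite mem_index_iota => /andP[i0 _].
  rewrite (@rqfac_lt0 _ _ (0%:Z + Negz i)); last by lia.
  rewrite (@rqfac_lt0 _ _ (0%:Z - i%:Z)); last by lia.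
  by rewrite !(mulr0, mul0r) addr0.
rewrite qfacS -mulrA exprnP -h_shift // mulr_bsumr.
rewrite -[in X in q ^ X](addn0 N.+1) addSn.
under eq_bsum do rewrite h_stepN.
rewrite bsumB -mulr_bsumr h_shift //; last by lia.
rewrite /qpoch big_ord_recr /= -/(qpoch _ _ _) -IHN; last by lia.
rewrite -exprnP; ring.
Qed.

End FiniteJacobi.

(** * Fibonacci weights and the inner multisum *)

Lemma fib_gt0 (n : nat) : (0 < fib n.+1)%N.
Proof. by elim: n => // n IHn; rewrite /= addn_gt0 IHn. Qed.

(** One step of [F_2^2 + ... + F_m^2 = F_m F_(m+1) - 1]; positivity keeps [.-1] from truncating. *)
Lemma fib_area (n : nat) :
  ((fib n.+1 * fib n.+2).-1 + fib n.+2 ^ 2 = (fib n.+2 * fib n.+3).-1)%N.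
Proof.
have := fib_gt0 n; have := fib_gt0 n.+1.
rewrite (_ : fib n.+3 = fib n.+2 + fib n.+1)%N //.
by move: (fib n.+2) (fib n.+1) => x y; nia.
Qed.

Section NestedSum.
Variables (C : fieldType) (q : C).
Hypotheses (q_neq0 : q != 0) (q_nroot : forall n : nat, 1 - q ^+ n.+1 != 0).
Hypothesis two_neq0 : (2 : C) != 0.

(** Here [z] is an index [m_j] and [M] is [m_(j-1) - m_j], so that [2 z + M - i] is
    [m_(j-1) + m_j - m_(j+1)]. In the base case the enclosing sum supplies [q^(z^2)], which
    completes [q^(z M)] to [q^(m_(k-3) m_(k-2))]. *)
Fixpoint nested (N n : nat) (z : nat) (M : int) : C :=
  if n is n'.+1 then
    \sum_(0 <= i < N) q ^+ (i ^ 2) * qbinom q ((2 * z)%N%:Z + M - i%:Z) (2 * z)%N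
      * nested N n' i (z%:Z - i%:Z)
  else q ^ (z%:Z * M) * qbinom q (z%:Z + M) z.

(** As [F_1 = F_2 = 1], the base case is [theta_qbinom2]. Each further sum over [i] is exchanged
    with the sum over [r]; Burge's transformation then raises both Fibonacci indices by one. *)
Lemma nested_fib (N n z : nat) (M : int) : (z < N)%N ->
  nested N n z M
  = bsum N (fun r => theta_coef q (fib n.+1 * fib n.+2).-1 r
      * qbinom2 q z M ((fib n.+2)%:Z * r) ((fib n.+1)%:Z * r)).
Proof.
elim: n z M => [|n IHn] z M zN.
  rewrite [LHS]/= -(theta_qbinom2 q_neq0 q_nroot M two_neq0 zN); apply: eq_bsum => r; rewrite !mul1r //.
rewrite [LHS]/=.
under eq_big_nat => i /andP[_ iN] do rewrite IHn // mulr_bsumr.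
rewrite exchange_bsum; apply: eq_bsum => r.
under eq_bigr do rewrite mulrCA.
by rewrite -mulr_sumr burge_transformz // mulrA theta_coefD fib_area.
Qed.

End NestedSum.

(** * Limits in R[i] *)

Lemma eq_cvg_from (T : topologicalType) (f g : nat -> T) (l : T) (N : nat) :
  (forall n, (N <= n)%N -> f n = g n) -> f @ \oo --> l -> g @ \oo --> l.
Proof.
move=> fg fl A /fl[M _ MA]; exists (maxn N M) => // n /=.
by rewrite geq_max => /andP[Nn Mn]; rewrite -fg //; exact: MA.
Qed.

Lemma cvg_natsum (K : numFieldType) (V : normedModType K) (f : nat -> nat -> V)
    (g : nat -> V) (I : nat) :
  (forall i, f n i @[n --> \oo] --> g i) ->
  (\sum_(0 <= i < I) f n i) @[n --> \oo] --> \sum_(0 <= i < I) g i.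
Proof.
move=> fg; elim: I => [|I IHI].
  by rewrite big_geq //; under eq_fun do rewrite big_geq //; exact: cvg_cst.
rewrite big_nat_recr //=; under eq_fun do rewrite big_nat_recr //=.
exact: cvgD IHI (fg I).
Qed.

Section ComplexNorm.
Variable R : realType.
Implicit Types (x y z : R[i]) (u v : nat -> R[i]).

(* The modulus as an element of R; the norm of R[i] takes values in R[i]. *)
Definition modulus z : R := complex.Re `|z|.

Lemma modulusE z : (modulus z)%:C%C = `|z|.
Proof. by rewrite /modulus normc_def. Qed.

Let modulus_inj (a b : R) : a%:C%C = b%:C%C -> a = b.
Proof. by case. Qed.

Lemma modulus_ge0 z : 0 <= modulus z.
Proof. by rewrite -lecR modulusE; exact: normr_ge0. Qed.

Lemma modulusM x y : modulus (x * y) = modulus x * modulus y.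
Proof. by apply: modulus_inj; rewrite rmorphM /= !modulusE normrM. Qed.

Lemma modulusN x : modulus (- x) = modulus x.
Proof. by rewrite /modulus normrN. Qed.

Lemma modulusD x y : modulus (x + y) <= modulus x + modulus y.
Proof. by rewrite -lecR rmorphD /= !modulusE; exact: ler_normD. Qed.

Lemma modulus1 : modulus 1 = 1.
Proof. by rewrite /modulus normr1. Qed.

Lemma modulus0 : modulus 0 = 0.
Proof. by rewrite /modulus normr0. Qed.

Lemma modulusX x n : modulus (x ^+ n) = modulus x ^+ n.
Proof. by elim: n => [|n IHn]; rewrite ?modulus1 // !exprS modulusM IHn. Qed.

Lemma modulusV x : modulus x^-1 = (modulus x)^-1.
Proof. by apply: modulus_inj; rewrite fmorphV /= !modulusE normfV. Qed.

Lemma modulus_sum (I : Type) (s : seq I) (P : pred I) (F : I -> R[i]) :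
  modulus (\sum_(i <- s | P i) F i) <= \sum_(i <- s | P i) modulus (F i).
Proof.
elim/big_ind2: _ => [|x1 x2 y1 y2 h1 h2|//]; first by rewrite modulus0.
by rewrite (le_trans (modulusD _ _)) // lerD.
Qed.

Lemma modulus_eq0 z : (modulus z == 0) = (z == 0).
Proof. by rewrite -[RHS]normr_eq0 -modulusE -(inj_eq modulus_inj). Qed.

Lemma modulus_le_ReIm z : modulus z <= `|complex.Re z| + `|complex.Im z|.
Proof.
case: z => a b; rewrite {1}[(a +i* b)%C]complexE.
apply: (le_trans (modulusD _ _)); rewrite /= modulusM.
have mr (c : R) : modulus c%:C%C = `|c|.
  by rewrite /modulus normc_def /= expr0n /= addr0 sqrtr_sqr.
by rewrite !mr /modulus normc_def /= expr0n /= add0r expr1n sqrtr1 mul1r.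
Qed.

(** A positive element of [R[i]] is a positive real, so the epsilons on both sides correspond. *)
Lemma cvg_modulusP u (l : R[i]) :
  u @ \oo --> l <-> (fun n => modulus (u n - l)) @ \oo --> (0 : R).
Proof.
split=> [/cvgrPdist_lt ul|ul].
  apply/cvgr0Pnorm_lt => e e0.
  have e0' : 0 < e%:C%C by rewrite ltcR.
  move: (ul _ e0'); apply: filterS => n.
  by rewrite distrC -modulusE ltcR ger0_norm // modulus_ge0.
apply/cvgrPdist_lt => e e0.
have [e1 e2] : complex.Im e = 0 /\ 0 < complex.Re e.
  by move: e0; rewrite ltcE => /andP[/eqP -> ->].
have -> : e = (complex.Re e)%:C%C by move: e1; case: (e) => a b /= ->.
move/cvgr0Pnorm_lt: ul => /(_ _ e2); apply: filterS => n.
by rewrite distrC -modulusE ltcR ger0_norm // modulus_ge0.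
Qed.

Lemma cvg_limC u (l : R[i]) : u @ \oo --> l -> lim (u @ \oo) = l.
Proof. by move=> ul; apply/cvg_lim; [exact: norm_hausdorff|exact: ul]. Qed.

Lemma le_limit_modulus u (l : R[i]) (B : R) :
  u @ \oo --> l -> (forall n, modulus (u n) <= B) -> modulus l <= B.
Proof.
move=> /cvg_modulusP/cvgr0Pnorm_lt ul uB; apply/ler_addgt0Pr => e e0.
have [n _ /(_ n (leqnn n))] := ul _ e0.
rewrite /= ger0_norm ?modulus_ge0 // => /ltW h.
have -> : l = u n - (u n - l) by rewrite subKr.
by rewrite (le_trans (modulusD _ _)) // modulusN lerD.
Qed.

Lemma geometric_sum_le (c s : R) (m n : nat) : 0 <= c -> 0 <= s < 1 ->
  \sum_(m <= i < n) c * s ^+ i <= c * s ^+ m / (1 - s).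
Proof.
move=> c0 /andP[s0 s1]; have s1' : 0 < 1 - s by rewrite subr_gt0.
have cs k : 0 <= c * s ^+ k by rewrite mulr_ge0 // exprn_ge0.
rewrite ler_pdivlMr // mulr_suml.
have [mn|nm] := leqP m n; last by rewrite big_geq ?cs // ltnW.
under eq_bigr => i _ do rewrite -mulrA mulrBr mulr1 -exprSr mulrBr -opprB.
rewrite sumrN telescope_sumr // opprB lerBlDr lerDl cs //.
Qed.

(** Real and imaginary parts have geometrically dominated increments, so completeness of [R] gives
    the limit componentwise. *)
Lemma cvg_geometric_increments u (c s : R) : 0 <= c -> 0 <= s < 1 ->
  (forall n, modulus (u n.+1 - u n) <= c * s ^+ n) ->
  exists l : R[i], u @ \oo --> l.
Proof.
move=> c0 s01 inc; case/andP: (s01) => s0 s1.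
have real_case (a : nat -> R) :
    (forall n, `|a n.+1 - a n| <= modulus (u n.+1 - u n)) -> exists l : R, a @ \oo --> l.
  move=> ha.
  have : cvgn (series (telescope a)).
    apply: normed_cvg.
    apply: (@series_le_cvg _ _ (geometric c s)) => [n|n|n|].
    - exact: normr_ge0.
    - exact: geometric_ge0.
    - exact: le_trans (ha n) (inc n).
    - by apply: is_cvg_geometric_series; rewrite ger0_norm.
  rewrite telescopeK => /cvg_ex[l hl]; exists (l + a 0%N).
  rewrite [X in X @ _ --> _](_ : a = (fun n => (a n - a 0%N) + a 0%N)).
    by apply: cvgD => //; exact: cvg_cst.
  by apply/funext => n; rewrite subrK.
have [a ha] : exists l : R, (fun n => complex.Re (u n)) @ \oo --> l.
  apply: real_case => n; rewrite -raddfB /=.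
  case: (u n.+1 - u n) => a b; rewrite /modulus normc_def /=.
  by rewrite -sqrtr_sqr ler_wsqrtr // lerDl sqr_ge0.
have [b hb] : exists l : R, (fun n => complex.Im (u n)) @ \oo --> l.
  apply: real_case => n; rewrite -raddfB /=.
  case: (u n.+1 - u n) => a' b; rewrite /modulus normc_def /=.
  by rewrite -sqrtr_sqr ler_wsqrtr // lerDr sqr_ge0.
exists (a +i* b)%C; apply/cvg_modulusP.
apply: (@squeeze_cvgr _ _ _ _ (fun=> 0)
  (fun n => `|complex.Re (u n) - a| + `|complex.Im (u n) - b|)).
- near=> n; rewrite modulus_ge0 /=.
  by have := modulus_le_ReIm (u n - (a +i* b)%C); case: (u n).
- exact: cvg_cst.
rewrite -[X in _ --> X](addr0 (0 : R)); apply: cvgD.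
  by apply/norm_cvg0P/subr_cvg0.
by apply/norm_cvg0P/subr_cvg0.
Unshelve. all: by end_near. Qed.

(** Stated as a difference, so that the limit of one sum can be read off from that of the other.
    Beyond a cut [I] the geometric bound leaves less than [e / 2]; the first [I] terms converge one
    by one. *)
Lemma tannery (f : nat -> nat -> R[i]) (g : nat -> R[i]) (s : nat -> nat) (c t : R) :
  0 <= c -> 0 <= t < 1 -> (forall n i, modulus (f n i) <= c * t ^+ i) ->
  (forall i, f n i @[n --> \oo] --> g i) ->
  (\sum_(0 <= i < s n) f n i - \sum_(0 <= i < s n) g i) @[n --> \oo] --> (0 : R[i]).
Proof.
move=> c0 t01 fc fg; case/andP: (t01) => t0 t1.
have gc i : modulus (g i) <= c * t ^+ i by apply: le_limit_modulus (fg i) _ => n.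
pose d n i := modulus (f n i - g i).
have dc n i : d n i <= (c *+ 2) * t ^+ i.
  rewrite (le_trans (modulusD _ _)) // modulusN mulrnAl mulr2n lerD //.
apply/cvg_modulusP/cvgr0Pnorm_lt => e e0.
have [I hI] : exists I, (c *+ 2) * t ^+ I / (1 - t) < e / 2.
  have : (fun n => (c *+ 2) / (1 - t) * t ^+ n) @ \oo --> (0 : R).
    rewrite -[X in _ --> X](mulr0 ((c *+ 2) / (1 - t))); apply: cvgMr.
    by apply: cvg_expr; rewrite ger0_norm.
  move=> /cvgr0Pnorm_lt /(_ (e / 2)) []; first by rewrite divr_gt0.
  move=> I _ /(_ I (leqnn I)) /= h; exists I.
  by rewrite mulrAC (le_lt_trans (ler_norm _)).
have hd : (fun n => \sum_(0 <= i < I) d n i) @ \oo --> (0 : R).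
  have h0 : \sum_(0 <= i < I) (0 : R) = 0 by rewrite big1.
  rewrite -[X in _ --> X]h0.
  by apply: (@cvg_natsum _ R^o d (fun=> 0)) => i; apply/cvg_modulusP.
move/cvgr0Pnorm_lt: hd => /(_ (e / 2)) []; first by rewrite divr_gt0.
move=> n0 _ hn0; exists n0 => // n /hn0 /= {}hn0.
rewrite subr0 ger0_norm ?modulus_ge0 // -sumrB.
apply: (le_lt_trans (modulus_sum _ _ _)); rewrite -/(d n _).
rewrite [e]splitr.
have dge0 i : 0 <= d n i by exact: modulus_ge0.
have [sI|Is] := leqP (s n) I.
  apply: (@le_lt_trans _ _ (\sum_(0 <= i < I) d n i)).
    by rewrite (@big_cat_nat _ _ _ (s n) 0%N I) //= lerDl sumr_ge0.
  apply: (le_lt_trans (ler_norm _)); apply: (lt_trans hn0).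
  by rewrite ltrDl divr_gt0.
rewrite (@big_cat_nat _ _ _ I) ?(ltnW Is) //= ltrD //.
  exact: le_lt_trans (ler_norm _) hn0.
apply: le_lt_trans hI; apply: le_trans (geometric_sum_le _ _ _ t01).
  by apply: ler_sum => i _; exact: dc.
by rewrite mulrn_wge0.
Qed.

End ComplexNorm.

(** * Limits of q-factorials, Burge's transformation at M = oo, and the Durfee sum *)

Section QLimits.
Variables (R : realType) (q : R[i]).
Hypothesis q_lt1 : modulus q < 1.

Let t := modulus q.
Let t0 : 0 <= t. Proof. exact: modulus_ge0. Qed.
Let t01 : 0 <= t < 1. Proof. by rewrite t0. Qed.
Let omt_gt0 : 0 < 1 - t. Proof. by rewrite subr_gt0. Qed.

(** Each factor satisfies [|1 - x q^i| <= 1 + |x| t^i <= exp(|x| t^i)], and the exponents form a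
    geometric series. *)
Lemma qpoch_bounded (x : R[i]) (n : nat) :
  modulus (qpoch x q n) <= expR (modulus x / (1 - t)).
Proof.
apply: (@le_trans _ _ (expR (\sum_(0 <= i < n) modulus x * t ^+ i))); last first.
  by rewrite ler_expR; have := geometric_sum_le 0 n (modulus_ge0 x) t01; rewrite expr0 mulr1.
elim: n => [|n IHn]; first by rewrite /qpoch big_ord0 big_geq // expR0 modulus1.
rewrite /qpoch big_ord_recr -/(qpoch _ _ _) big_nat_recr //= modulusM expRD.
rewrite ler_pM ?modulus_ge0 //; apply: le_trans (expR_ge1Dx _).
by rewrite (le_trans (modulusD _ _)) // modulus1 modulusN modulusM modulusX.
Qed.

Lemma cvg_qpoch (x : R[i]) : qpoch x q n @[n --> \oo] --> qpoch_inf x q.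
Proof.
have [l ul] : exists l : R[i], qpoch x q n @[n --> \oo] --> l.
  apply: (@cvg_geometric_increments _ _ (modulus x * expR (modulus x / (1 - t))) t) => //.
    by rewrite mulr_ge0 ?modulus_ge0 ?expR_ge0.
  move=> n; rewrite /qpoch big_ord_recr -/(qpoch _ _ _) /=.
  rewrite -[X in _ * _ - X]mulr1 -mulrBr addrAC subrr add0r mulrN modulusN.
  rewrite !modulusM modulusX mulrC -mulrA -mulrA ler_wpM2l ?modulus_ge0 //.
  by rewrite mulrC ler_wpM2r ?qpoch_bounded ?exprn_ge0.
by rewrite /qpoch_inf (cvg_limC ul).
Qed.

Let modulus_1Bq (n : nat) : 1 - t ^+ n.+1 <= modulus (1 - q ^+ n.+1).
Proof.
rewrite lerBlDr -modulusX -{1}modulus1.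
by rewrite -{1}(subrK (q ^+ n.+1) 1) modulusD.
Qed.

Let omtn_gt0 (n : nat) : 0 < 1 - t ^+ n.+1.
Proof. by rewrite subr_gt0 exprn_ilt1. Qed.

Lemma one_sub_exp_neq0 (n : nat) : 1 - q ^+ n.+1 != 0.
Proof. by rewrite -modulus_eq0 gt_eqF // (lt_le_trans (omtn_gt0 n)). Qed.

(** The exponential bound again, now from [1 / (1 - t^(n+1)) <= 1 + t^n / (1 - t)]. *)
Let qfac_inv_bounded (n : nat) : modulus (qfac q n)^-1 <= expR ((1 - t)^-1 / (1 - t)).
Proof.
apply: (@le_trans _ _ (expR (\sum_(0 <= i < n) (1 - t)^-1 * t ^+ i))); last first.
  have c0 : 0 <= (1 - t)^-1 by rewrite invr_ge0 ltW.
  by rewrite ler_expR; have := geometric_sum_le 0 n c0 t01; rewrite expr0 mulr1.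
elim: n => [|n IHn].
  by rewrite /qfac /qpoch big_ord0 big_geq // expR0 invr1 modulus1.
rewrite qfacS big_nat_recr //= expRD invfM modulusM ler_pM ?modulus_ge0 //.
apply: le_trans (expR_ge1Dx _); rewrite modulusV.
apply: (@le_trans _ _ (1 - t ^+ n.+1)^-1).
  by rewrite lef_pV2 ?posrE // (lt_le_trans (omtn_gt0 n)).
have tn0 : 0 <= t ^+ n by rewrite exprn_ge0.
have tn1 : t ^+ n <= 1 by rewrite exprn_ile1 // ltW.
rewrite -[X in X <= _]mul1r ler_pdivrMr // exprS.
have := omtn_gt0 n; rewrite exprS => h.
rewrite -(ler_pM2l omt_gt0) mulr1 mulrA [X in _ <= X * _]mulrDr mulr1 mulVKf ?gt_eqF //.
move: (t ^+ n) tn0 tn1 => y y0 y1; rewrite -subr_ge0.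
rewrite (_ : _ - _ = y * (1 - t) ^+ 2 + y * t * (1 - y)); last by ring.
by apply: addr_ge0; [exact: mulr_ge0 (sqr_ge0 _)|rewrite !mulr_ge0 ?subr_ge0].
Qed.

Lemma qfac_rqfac_bounded : exists2 B : R, 0 <= B &
  forall n, modulus (qfacz q n) <= B /\ modulus (rqfac q n) <= B.
Proof.
pose B1 := expR (modulus q / (1 - t)); pose B2 := expR ((1 - t)^-1 / (1 - t)).
have B1_ge0 : 0 <= B1 by exact: expR_ge0.
have B2_ge0 : 0 <= B2 by exact: expR_ge0.
exists (B1 + B2) => [|n]; first exact: addr_ge0.
split; first by rewrite (le_trans (qpoch_bounded _ _)) // lerDl.
case: n => [n|n]; last by rewrite rqfac_lt0 // modulus0 addr_ge0.
by rewrite (le_trans (qfac_inv_bounded n)) // lerDr.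
Qed.

(** Were the limit 0, some [|(q)_n|] would be below [1 / (B + 1)] while [|1 / (q)_n| <= B]; their
    product, which is 1, would be at most [B / (B + 1)]. *)
Lemma qpoch_inf_neq0 : qpoch_inf q q != 0.
Proof.
have [B B0 hB] := qfac_rqfac_bounded; apply/eqP => E0.
have := @cvg_qpoch q; rewrite E0 => /cvg_modulusP/cvgr0Pnorm_lt.
have B1 : 0 < (B + 1)^-1 by rewrite invr_gt0 ltr_wpDl.
move=> /(_ _ B1)[n _ /(_ n (leqnn n))] /=.
rewrite subr0 ger0_norm ?modulus_ge0 // -/(qfac q n) => h.
have := qfaczK one_sub_exp_neq0 (isT : 0 <= n%:Z) => /(congr1 (@modulus R)).
rewrite modulusM modulus1 /qfacz /= => e.
have [_ hn] := hB n%:Z.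
have : modulus (qfac q n) * modulus (rqfac q n) <= (B + 1)^-1 * B.
  by apply: ler_pM; rewrite ?modulus_ge0 // ltW.
rewrite e mulrC ler_pdivlMr ?ltr_wpDl // mul1r => h'.
by move: h'; rewrite gerDl ler10.
Qed.

Lemma cvg_qfacz (f : nat -> int) (c : nat) : (forall n, n%:Z <= f n + c%:Z) ->
  qfacz q (f n) @[n --> \oo] --> qpoch_inf q q.
Proof.
move=> fc; apply: (@cvg_comp _ _ _ (fun n => `|f n|%N) (qpoch q q) _ \oo); last exact: cvg_qpoch.
move=> A [N _ NA]; exists (N + c)%N => // n /= Nn; apply: NA => /=.
by have := fc n; lia.
Qed.

Lemma cvg_rqfac (f : nat -> int) (c : nat) : (forall n, n%:Z <= f n + c%:Z) ->
  rqfac q (f n) @[n --> \oo] --> (qpoch_inf q q)^-1.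
Proof.
move=> fc.
have h : (qfacz q (f n))^-1 @[n --> \oo] --> (qpoch_inf q q)^-1.
  exact: cvgV qpoch_inf_neq0 (cvg_qfacz fc).
apply: (@eq_cvg_from _ _ (fun n => rqfac q (f n)) _ c _ h) => n cn; have : 0 <= f n by have := fc n; lia.
by case: (f n).
Qed.

Hypothesis q_neq0 : q != 0.
Let q_nroot := one_sub_exp_neq0.
Let E_neq0 := qpoch_inf_neq0.

(** Let [M -> oo] in [burge_transformz]: the q-binomial tends to [1/(q)_(2L)], and on the right the
    factors [(q)_oo] cancel. This evaluates the sum over [m_2], which carries [1/(q)_(2 m_1)]. *)
Lemma burge_limit (N L a b : nat) (r : int) : (L < N)%N ->
  \sum_(0 <= i < N) q ^+ (i ^ 2) * rqfac q (2 * L)%N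
    * qbinom2 q i (L%:Z - i%:Z) (a%:Z * r) (b%:Z * r)
  = q ^+ (a ^ 2 * `|r| ^ 2)
    * (rqfac q (L%:Z + (a + b)%N%:Z * r) * rqfac q (L%:Z - (a + b)%N%:Z * r)).
Proof.
move=> LN.
pose F (M : nat) := \sum_(0 <= i < N)
  q ^+ (i ^ 2) * qbinom q ((2 * L)%N%:Z + M%:Z - i%:Z) (2 * L)%N
    * qbinom2 q i (L%:Z - i%:Z) (a%:Z * r) (b%:Z * r).
have F_lim : F @ \oo --> \sum_(0 <= i < N) q ^+ (i ^ 2) * rqfac q (2 * L)%N
    * qbinom2 q i (L%:Z - i%:Z) (a%:Z * r) (b%:Z * r).
  apply: cvg_natsum => i; apply: cvgM; last exact: cvg_cst.
  apply: cvgM; first exact: cvg_cst.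
  rewrite -[X in _ --> X](_ : qpoch_inf q q * rqfac q (2 * L)%N * (qpoch_inf q q)^-1 = _).
    under eq_fun do rewrite qbinomE.
    apply: cvgM; first apply: cvgM; [|exact: cvg_cst|].
      by apply: (@cvg_qfacz _ i) => n; lia.
    by apply: (@cvg_rqfac _ i) => n; lia.
  by rewrite mulrAC mulfV // mul1r.
set s := (a + b)%N%:Z * r.
have F_lim' : F @ \oo --> q ^+ (a ^ 2 * `|r| ^ 2)
    * (rqfac q (L%:Z + s) * rqfac q (L%:Z - s)).
  rewrite -[X in _ --> X](_ : q ^+ (a ^ 2 * `|r| ^ 2) * (qpoch_inf q q * qpoch_inf q q *
    (rqfac q (L%:Z + s) * rqfac q (L%:Z - s) * ((qpoch_inf q q)^-1 * (qpoch_inf q q)^-1))) = _).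
    rewrite /F; under eq_fun do rewrite burge_transformz // /qbinom2 -/s.
    apply: cvgM; first exact: cvg_cst.
    apply: cvgM; apply: cvgM.
    - by apply: (@cvg_qfacz _ `|(s - a%:Z * r)%R|%N) => n; lia.
    - by apply: (@cvg_qfacz _ `|(s - a%:Z * r)%R|%N) => n; lia.
    - exact: cvg_cst.
    apply: cvgM.
    - by apply: (@cvg_rqfac _ `|(a%:Z * r)%R|%N) => n; lia.
    - by apply: (@cvg_rqfac _ `|(a%:Z * r)%R|%N) => n; lia.
  by move: (rqfac _ _) (rqfac _ _) => y1 y2; field.
by rewrite -(cvg_limC F_lim) (cvg_limC F_lim').
Qed.

(** The sum over [m_1], cut off at [N]. Up to [q^(s^2)] the full series counts partitions by their
    Durfee rectangles; terms with [m < |s|] vanish. *)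
Definition durfee (N : nat) (s : int) : R[i] :=
  \sum_(0 <= m < N) q ^+ (m ^ 2) * (rqfac q (m%:Z - s) * rqfac q (m%:Z + s)).

Lemma durfeeN (N : nat) (s : int) : durfee N (- s) = durfee N s.
Proof. by apply: eq_bigr => m _; rewrite opprK [rqfac _ _ * _]mulrC. Qed.

Let leq_expn2 (n : nat) : (n <= n ^ 2)%N.
Proof. by case: n => // n; rewrite -mulnn leq_pmulr. Qed.

Let modulus_exp_le (n m : nat) : (m <= n)%N -> modulus (q ^+ n) <= t ^+ m.
Proof. by move=> mn; rewrite modulusX ler_wiXn2l // ltW. Qed.

(** Uniformity in [s] as well as in [N] is what dominates the later sum over [r], in which [s] is a
    multiple of [r]. *)
Lemma durfee_bounded : exists2 B : R, 0 <= B & forall N s, modulus (durfee N s) <= B.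
Proof.
have [B B0 hB] := qfac_rqfac_bounded; exists (B * B * t ^+ 0 / (1 - t)).
  by rewrite expr0 mulr1 !mulr_ge0 // invr_ge0 ltW.
move=> N s; apply: (le_trans (modulus_sum _ _ _)).
apply: (le_trans _ (geometric_sum_le 0 N (mulr_ge0 B0 B0) t01)).
apply: ler_sum => m _; rewrite !modulusM mulrC.
have [_ h1] := hB (m%:Z - s); have [_ h2] := hB (m%:Z + s).
rewrite ler_pM ?mulr_ge0 ?modulus_ge0 ?ler_pM ?modulus_ge0 //.
by rewrite modulus_exp_le // leq_expn2.
Qed.

(* Tannery's theorem applied to the finite sum [burge_limit] with [b = 0]. *)
Lemma cvg_durfee (s : int) :
  durfee N s @[N --> \oo] --> q ^+ (`|s| ^ 2) / qpoch_inf q q.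
Proof.
wlog s0 : s / 0 <= s => [H|].
  have [/H //|/ltW] := leP 0 s; rewrite -oppr_ge0 => /H; rewrite abszN.
  by under eq_fun do rewrite durfeeN.
case: s s0 => // s _.
rewrite -(cvg_shiftS (fun N => durfee N s)) /=.
have [B B0 hB] := qfac_rqfac_bounded.
(* The ratio [(q)_(2L) / (q)_(2L)] is 1 and brings the summand into the form of [burge_limit]. *)
pose f (L i : nat) := q ^+ (i ^ 2) * (qfacz q (2 * L)%N * rqfac q (2 * L)%N)
  * qbinom2 q i (L%:Z - i%:Z) (s%:Z * 1) (0%N%:Z * 1).
pose g (i : nat) := q ^+ (i ^ 2) * (rqfac q (i%:Z - s%:Z) * rqfac q (i%:Z + s%:Z)).
have fE (L i : nat) : f L i = q ^+ (i ^ 2) * (qfacz q (L%:Z + s%:Z) * qfacz q (L%:Z - s%:Z)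
  * (rqfac q (i%:Z + s%:Z) * rqfac q (i%:Z - s%:Z) * (rqfac q (L%:Z - i%:Z) * rqfac q (L%:Z - i%:Z)))).
  rewrite /f qfaczK // mulr1 /qbinom2 mul0r ?subr0 ?addr0 mulr1.
  by rewrite (_ : i%:Z + (L%:Z - i%:Z) = L%:Z) //; lia.
have fsum L : \sum_(0 <= i < L.+1) f L i
    = qfacz q (2 * L)%N * (q ^+ (s ^ 2) * (rqfac q (L%:Z + s%:Z) * rqfac q (L%:Z - s%:Z))).
  have := @burge_limit L.+1 L s 0 1 (ltnSn L); rewrite addn0 !mulr1 exp1n muln1 => <-.
  rewrite mulr_sumr; apply: eq_bigr => i _; rewrite /f mulr1; ring.
have fsum_cvg : \sum_(0 <= i < L.+1) f L i @[L --> \oo] --> q ^+ (s ^ 2) / qpoch_inf q q.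
  rewrite -[X in _ --> X](_ : qpoch_inf q q * (q ^+ (s ^ 2) * ((qpoch_inf q q)^-1 * (qpoch_inf q q)^-1)) = _); last by field.
  under eq_fun do rewrite fsum.
  apply: cvgM; first by apply: (@cvg_qfacz _ 0%N) => n; lia.
  apply: cvgM; first exact: cvg_cst.
  by apply: cvgM; apply: (@cvg_rqfac _ s) => n; lia.
have : (\sum_(0 <= i < L.+1) f L i - \sum_(0 <= i < L.+1) g i) @[L --> \oo] --> (0 : R[i]).
  apply: (@tannery _ f g S (B * B * (B * B * (B * B))) t).
  - by rewrite !mulr_ge0.
  - exact: t01.
  - move=> L i; rewrite fE modulusM mulrC ler_pM ?modulus_ge0 //; last first.
      by rewrite modulus_exp_le // leq_expn2.
    rewrite !modulusM !ler_pM ?mulr_ge0 ?modulus_ge0 //;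
      by [apply: (hB _).1 | apply: (hB _).2].
  - move=> i.
  rewrite -[X in _ --> X](_ : q ^+ (i ^ 2) * (qpoch_inf q q * qpoch_inf q q *
    (rqfac q (i%:Z + s%:Z) * rqfac q (i%:Z - s%:Z) * ((qpoch_inf q q)^-1 * (qpoch_inf q q)^-1))) = _);
    last by rewrite /g; move: (rqfac _ _) (rqfac _ _) => y1 y2; field.
  under eq_fun do rewrite fE.
  apply: cvgM; first exact: cvg_cst.
  apply: cvgM; apply: cvgM.
  - by apply: (@cvg_qfacz _ s) => n; lia.
  - by apply: (@cvg_qfacz _ s) => n; lia.
  - exact: cvg_cst.
  - by apply: cvgM; apply: (@cvg_rqfac _ i) => n; lia.
move=> hfg.
have fg_lim : (fun L => \sum_(0 <= i < L.+1) f L i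
    - (\sum_(0 <= i < L.+1) f L i - \sum_(0 <= i < L.+1) g i)) @ \oo
  --> q ^+ (s ^ 2) / qpoch_inf q q - 0 by exact: cvgB fsum_cvg hfg.
rewrite subr0 in fg_lim.
by apply: eq_cvg_from (0 : nat) _ fg_lim => L _; rewrite subKr.
Qed.

End QLimits.

(** * The multisum *)

Section TupleSum.
Variables (C : fieldType) (q : C).

Lemma big_cons_tuple (N n : nat) (F : n.+1.-tuple 'I_N -> C) :
  \sum_(u : n.+1.-tuple 'I_N) F u
  = \sum_(x : 'I_N) \sum_(u : n.-tuple 'I_N) F (cons_tuple x u).
Proof.
rewrite pair_bigA /= (reindex (fun p : 'I_N * n.-tuple 'I_N => cons_tuple p.1 p.2)) //.
exists (fun u => (thead u, behead_tuple u)) => [[x u] _|u _] /=.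
  by rewrite theadE; congr (_, _); apply: val_inj.
by rewrite [RHS]tuple_eta; apply: val_inj.
Qed.

(* The summand of the theorem without its factor [q ^ (m 0 ^ 2) / (q)_{2 m 0}];
   the indices [m 0, ..., m n.+1] are those of the theorem shifted by one. *)
Definition chain (n : nat) (m : nat -> nat) : C :=
  q ^+ (\sum_(0 <= i < n) m i.+1 ^ 2 + m n * m n.+1)
  * (\prod_(0 <= j < n) qbinom q ((m j)%:Z + (m j.+1)%:Z - (m j.+2)%:Z) (2 * m j.+1)%N)
  * qbinom q (m n) (m n.+1).

Lemma chainS (n : nat) (m : nat -> nat) :
  chain n.+1 m = qbinom q ((m 0%N)%:Z + (m 1%N)%:Z - (m 2%N)%:Z) (2 * m 1%N)%N
    * (q ^+ (m 1%N ^ 2) * chain n (fun i => m i.+1)).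
Proof.
rewrite /chain !big_nat_recl // -addnA exprD.
by rewrite -!mulrA [RHS]mulrCA; congr (_ * _); rewrite mulrCA.
Qed.

(** The weight [g] makes the induction possible: the q-binomial split off by [chainS] also involves
    the next index, so it is handed to the induction hypothesis as the new weight. *)
Lemma sum_chain (N n y : nat) (g : nat -> C) :
  \sum_(u : n.+1.-tuple 'I_N)
    g (nth 0%N (map val u) 0) * chain n (nth 0%N (y :: map val u))
  = \sum_(0 <= z < N) g z * (q ^+ (z ^ 2) * nested q N n z (y%:Z - z%:Z)).
Proof.
elim: n y g => [|n IHn] y g; rewrite big_cons_tuple big_mkord; apply: eq_bigr => z _.
  rewrite (big_pred1 [tuple]) => [|u]; last by apply/esym/eqP; exact: tuple0.
  rewrite /chain /= !big_geq // add0n mulr1; congr (_ * _).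
  rewrite (_ : z%:Z + (y%:Z - z%:Z) = y%:Z); last by lia.
  (* For [z > y] both sides contain a zero q-binomial; otherwise [z^2 + z (y - z) = y z]. *)
  have [zy|yz] := leqP z y; last first.
    by rewrite /qbinom lez_nat leqNgt yz andbF !mulr0.
  rewrite mulrA; congr (_ * _).
  have -> : z%:Z * (y%:Z - z%:Z) = (z * (y - z))%N by rewrite PoszM -subzn.
  by rewrite -exprnP -exprD; congr (_ ^+ _); rewrite -mulnn -mulnDr subnKC // mulnC.
under eq_bigr do rewrite chainS /=.
rewrite -mulr_sumr; congr (_ * _).
have e := IHn z (fun i => qbinom q (y%:Z + z%:Z - i%:Z) (2 * z)%N).
under eq_bigr do rewrite mulrCA.
rewrite -mulr_sumr; congr (_ * _); rewrite e /=.
apply: eq_bigr => i _; rewrite mulrA [_ * q ^+ _]mulrC.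
by congr (_ * qbinom q _ _ * _); lia.
Qed.

End TupleSum.

Lemma lhs_term_chain (R : realType) (q : R[i]) (n : nat) (m : nat -> nat) :
  lhs_term q n.+4 m
  = q ^+ (m 1%N ^ 2) / qfac q (2 * m 1%N) * chain q n (fun i => m i.+1).
Proof.
rewrite /lhs_term /chain !subSS !subn0.
rewrite big_add1 (_ : n.+2.-1 = n.+1) // big_nat_recl // -addnA exprD.
rewrite (big_addn 0 n.+2 2) subn2.
under [X in _ * X * qbinom _ _ _]eq_bigr do rewrite addn2.
by rewrite -!mulrA; congr (_ * _); rewrite mulrCA.
Qed.

Lemma lhs_partialE (R : realType) (q : R[i]) (n N : nat) :
  lhs_partial q n.+4 N
  = \sum_(0 <= x < N) q ^+ (x ^ 2) / qfac q (2 * x)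
      * \sum_(0 <= z < N) q ^+ (z ^ 2) * nested q N n z (x%:Z - z%:Z).
Proof.
rewrite /lhs_partial (_ : n.+4 - 2 = n.+2)%N // big_cons_tuple big_mkord.
apply: eq_bigr => x _.
have := sum_chain q N n x (fun=> 1).
under eq_bigr do rewrite mul1r.
under [in RHS]eq_big_nat do rewrite mul1r.
move=> <-; rewrite mulr_sumr; apply: eq_bigr => u _.
by rewrite lhs_term_chain.
Qed.

(** * The limit of the sum over r and Jacobi's triple product *)

Section Limit.
Variables (R : realType) (q : R[i]).
Hypotheses (q_lt1 : modulus q < 1) (q_neq0 : q != 0).

Let q_nroot := one_sub_exp_neq0 q_lt1.

(** Exact for every [N]: [nested_fib] is followed by one more Burge step, [burge_limit], and the
    remaining sum over [m_1] is [durfee]. *)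
Lemma lhs_partial_durfee (n N : nat) :
  lhs_partial q n.+4 N
  = bsum N (fun r => theta_coef q (fib n.+2 * fib n.+3).-1 r
                     * durfee q N ((fib n.+3)%:Z * r)).
Proof.
rewrite lhs_partialE.
have two_neq0 : (2 : R[i]) != 0 by rewrite pnatr_eq0.
transitivity (\sum_(0 <= x < N) bsum N (fun r => theta_coef q (fib n.+2 * fib n.+3).-1 r
  * (q ^+ (x ^ 2) * (rqfac q (x%:Z - (fib n.+3)%:Z * r) * rqfac q (x%:Z + (fib n.+3)%:Z * r))))).
  apply: eq_big_nat => x /andP[_ xN].
  under eq_big_nat => z /andP[_ zN] do rewrite nested_fib // mulr_bsumr.
  rewrite exchange_bsum mulr_bsumr; apply: eq_bsum => r.
  rewrite -fib_area -theta_coefD.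
  have := burge_limit q_lt1 q_neq0 (fib n.+2) (fib n.+1) r xN.
  rewrite (_ : (fib n.+2 + fib n.+1)%N = fib n.+3) // => e.
  rewrite [rqfac q (x%:Z - _) * _]mulrC -mulrA [X in _ = _ * X]mulrCA -e.
  rewrite !mulr_sumr; apply: eq_bigr => z _.
  by rewrite /rqfac; ring.
by rewrite exchange_bsum; apply: eq_bsum => r; rewrite mulr_sumr.
Qed.

(** For [e > 0] the exponent in [theta_coef] is at least [|r|], which gives geometric domination;
    the terms at [i] and [- i - 1] are taken together, hence the constant [2 B]. *)
Lemma bsum_tannery (e : nat) (h : nat -> int -> R[i]) (hl : int -> R[i])
    (s : nat -> nat) (B : R) : (0 < e)%N -> 0 <= B ->
  (forall n r, modulus (h n r) <= B) ->
  (forall r, h n r @[n --> \oo] --> hl r) ->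
  (bsum (s n) (fun r => theta_coef q e r * h n r)
   - bsum (s n) (fun r => theta_coef q e r * hl r)) @[n --> \oo] --> (0 : R[i]).
Proof.
move=> e0 B0 hB hh.
have theta_le (r : int) (i : nat) : (i <= `|r|)%N -> modulus (theta_coef q e r) <= modulus q ^+ i.
  move=> ir; rewrite modulusM.
  have -> : modulus ((-1) ^ r : R[i]) = 1.
    case: r {ir} => [m|m]; rewrite ?NegzE -?invr_expz -exprnP ?modulusV modulusX modulusN modulus1.
      by rewrite expr1n.
    by rewrite expr1n invr1.
  rewrite mul1r modulusX ler_wiXn2l ?modulus_ge0 ?(ltW q_lt1) //.
  rewrite (leq_trans ir) // (@leq_trans (`|r| ^ 2)) //.
    by case: `|r|%N => // k; rewrite -mulnn leq_pmulr.
  by rewrite (@leq_trans (e * `|r| ^ 2)) ?leq_addr // leq_pmull.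
apply: (@tannery _
  (fun n i => theta_coef q e i * h n i + theta_coef q e (Negz i) * h n (Negz i))
  (fun i => theta_coef q e i * hl i + theta_coef q e (Negz i) * hl (Negz i)) s (B *+ 2)
  (modulus q)).
- by rewrite mulrn_wge0.
- by rewrite modulus_ge0.
- move=> n i; apply: (le_trans (modulusD _ _)); rewrite mulrnAl mulr2n.
  rewrite (modulusM (theta_coef q e i)) (modulusM (theta_coef q e (Negz i))).
  by apply: lerD; rewrite mulrC; apply: ler_pM; rewrite ?modulus_ge0 ?hB ?theta_le /= ?leqnSn.
- move=> i; apply: cvgD; apply: cvgM; (exact: cvg_cst || exact: hh).
Qed.

(* Jacobi's triple product in base [q ^ (2 e + 1)] at [z = q ^ (e + 1)]. *)
Lemma cvg_theta (e : nat) : (0 < e)%N ->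
  bsum N (theta_coef q e) @[N --> \oo] -->
  qpoch_inf (q ^+ e) (q ^+ e.*2.+1) * qpoch_inf (q ^+ e.+1) (q ^+ e.*2.+1)
  * qpoch_inf (q ^+ e.*2.+1) (q ^+ e.*2.+1).
Proof.
move=> e0; set Q := q ^+ e.*2.+1; set z := q ^+ e.+1.
have Q_lt1 : modulus Q < 1 by rewrite modulusX exprn_ilt1 ?modulus_ge0.
have Q_neq0 : Q != 0 by rewrite expf_neq0.
have z_neq0 : z != 0 by rewrite expf_neq0.
have E_neq0 := qpoch_inf_neq0 Q_lt1.
have Qz : Q / z = q ^+ e.
  by apply: (mulIf z_neq0); rewrite divfK // -exprD; congr (_ ^+ _); lia.
(* The exponents agree since [e (2 r + 1) + r + 1 = (e + 1) + (2 e + 1) r]. *)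
have WS (r : int) : theta_coef q e (r + 1) = - (z * Q ^ r) * theta_coef q e r.
  rewrite theta_coefS //; congr (- _ * _).
  by rewrite /z /Q !exprnP exprz_exp -expfzDr //; congr (_ ^ _); lia.
(* For [|r| <= n] this is the q-binomial [[2 n; n + r]] in base [Q]; its limit [1/(Q; Q)_oo] is
   independent of [r] and is cleared at the end. *)
pose h (n : nat) (r : int) := qfacz Q (n + n)%N * (rqfac Q (n%:Z + r) * rqfac Q (n%:Z - r)).
have [B B0 hB] := qfac_rqfac_bounded Q_lt1.
have h_le n r : modulus (h n r) <= B * (B * B).
  rewrite !modulusM !ler_pM ?mulr_ge0 ?modulus_ge0 //;
    by [apply: (hB _).1 | apply: (hB _).2].
have h_lim r : h n r @[n --> \oo] --> (qpoch_inf Q Q)^-1.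
  rewrite -[X in _ --> X](_ : qpoch_inf Q Q * ((qpoch_inf Q Q)^-1 * (qpoch_inf Q Q)^-1) = _);
    last by rewrite mulrA mulfV // mul1r.
  apply: cvgM; first by apply: (cvg_qfacz Q_lt1 (c := 0)) => n; lia.
  by apply: cvgM; apply: (cvg_rqfac Q_lt1 (c := `|r|%N)) => n; lia.
have jacobi n : bsum n.+1 (fun r => theta_coef q e r * h n r) = qpoch z Q n * qpoch (q ^+ e) Q n.
  rewrite -Qz -(finite_jacobi Q_neq0 (one_sub_exp_neq0 Q_lt1) z_neq0 (theta_coef0 q e) WS (ltnSn n) (ltnSn n)).
  by rewrite mulr_bsumr; apply: eq_bsum => r; rewrite mulrCA.
have BB0 : 0 <= B * (B * B) by rewrite !mulr_ge0.
have diff := bsum_tannery S e0 BB0 h_le h_lim.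
have prod_lim : bsum n.+1 (fun r => theta_coef q e r * h n r) @[n --> \oo] -->
    qpoch_inf z Q * qpoch_inf (q ^+ e) Q.
  under eq_fun do rewrite jacobi.
  by apply: cvgM; apply: cvg_qpoch.
have sum_lim : ((bsum n.+1 (fun r => theta_coef q e r * h n r)
    - (bsum n.+1 (fun r => theta_coef q e r * h n r)
      - bsum n.+1 (fun r => theta_coef q e r / qpoch_inf Q Q))) * qpoch_inf Q Q) @[n --> \oo] -->
    (qpoch_inf z Q * qpoch_inf (q ^+ e) Q - 0) * qpoch_inf Q Q.
  by apply: cvgM; [exact: cvgB prod_lim diff|exact: cvg_cst].
rewrite subr0 [qpoch_inf z Q * _]mulrC in sum_lim.
rewrite -(cvg_shiftS (fun N => bsum N (theta_coef q e))) /=.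
apply: eq_cvg_from (0 : nat) _ sum_lim => n _.
by rewrite subKr mulr_bsuml; apply: eq_bsum => r; rewrite divfK.
Qed.

End Limit.

(** * The case q = 0 *)

Lemma qpoch_inf0 (R : realType) (q : R[i]) : qpoch_inf 0 q = 1.
Proof.
rewrite /qpoch_inf (_ : (fun n => _) = fun=> 1).
  by apply: cvg_limC; exact: cvg_cst.
by apply/funext => n; rewrite /qpoch big1 // => i _; rewrite mul0r subr0.
Qed.

Lemma qfac0 (C : comUnitRingType) (n : nat) : qfac (0 : C) n = 1.
Proof. by rewrite /qfac /qpoch big1 // => i _; rewrite mul0r subr0. Qed.

(** Since [0 ^+ 0 = 1], the term [i = 0] survives; every other power is zero. *)
Lemma sum_expr0_sq (C : pzRingType) (N : nat) (F : nat -> C) :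
  \sum_(0 <= i < N.+1) (0 : C) ^+ (i ^ 2) * F i = F 0.
Proof.
rewrite big_ltn // big1_seq => [|i].
  by rewrite addr0 expr0 mul1r.
rewrite mem_index_iota => /andP[_ /andP[i0 _]].
by rewrite expr0n expn_eq0 gtn_eqF // mul0r.
Qed.

Lemma nested0 (C : fieldType) (N n : nat) : nested (0 : C) N.+1 n 0 0 = 1.
Proof.
have b00 : qbinom (0 : C) 0 0 = 1 by rewrite /qbinom /= !qfac0 mulr1 divr1.
elim: n => [|n IHn] /=; first by rewrite mul0r expr0z mul1r addr0.
under eq_bigr do rewrite -mulrA.
rewrite sum_expr0_sq.
have -> : qbinom (0 : C) ((2 * 0)%N%:Z + 0 - 0%N%:Z) (2 * 0)%N = 1 by exact: b00.
by rewrite mul1r; exact: IHn.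
Qed.

Lemma lhs_partial0 (R : realType) (n N : nat) : lhs_partial (0 : R[i]) n.+4 N.+1 = 1.
Proof.
rewrite lhs_partialE; under eq_bigr do rewrite -mulrA sum_expr0_sq.
by rewrite sum_expr0_sq qfac0 invr1 mul1r; exact: nested0.
Qed.

(** * Combination of the exact formula with the limits *)

Unset Implicit Arguments. Set Strict Implicit.

Theorem theorem1p5 (R : realType) (q : R[i]) (k : nat) :
  `|q| < 1 -> (4 <= k)%N ->
  (fun N => lhs_partial q k N) @ \oo --> rhs q k.
Proof.
move=> q_lt1 k4.
have {}q_lt1 : modulus q < 1 by rewrite -ltcR modulusE.
rewrite -(subnKC k4); move: (k - 4)%N => n {k k4}; rewrite !addSn add0n.
have L_gt1 : (1 < fib n.+4 * fib n.+3)%N.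
  have := fib_gt0 n; have := fib_gt0 n.+1.
  rewrite (_ : fib n.+4 = fib n.+3 + fib n.+2)%N // (_ : fib n.+3 = fib n.+2 + fib n.+1)%N //.
  by move: (fib n.+2) (fib n.+1) => x y; nia.
have [->|q_neq0] := eqVneq q 0.
  rewrite /rhs /= !expr0n.
  have -> : (fib n.+4 * fib n.+3 == 0)%N = false by lia.
  have -> : ((fib n.+4 * fib n.+3).-1 == 0)%N = false by lia.
  have -> : ((2 * (fib n.+4 * fib n.+3)).-1 == 0)%N = false by lia.
  rewrite !qpoch_inf0 !mulr1 divr1.
  (* The comparison starts at [N = 1] because the partial sum for [N = 0] is empty. *)
  apply: eq_cvg_from (1 : nat) _ (cvg_cst (1 : R[i])) => [[//|N _]].
  by rewrite lhs_partial0.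
pose e := (fib n.+3 * fib n.+4).-1.
have e_gt0 : (0 < e)%N by rewrite /e; lia.
(* [e'] is the coefficient of [r^2] before the sum over [m_1], which adds [F_(k-1)^2] and turns it
   into [e]. *)
pose e' := (fib n.+2 * fib n.+3).-1.
have e'_gt0 : (0 < e')%N.
  rewrite /e'; have := fib_gt0 n; have := fib_gt0 n.+1.
  rewrite (_ : fib n.+3 = fib n.+2 + fib n.+1)%N //.
  by move: (fib n.+2) (fib n.+1) => x y; nia.
have [B B0 hB] := durfee_bounded q_lt1.
have durfee_lim (r : int) : durfee q N ((fib n.+3)%:Z * r) @[N --> \oo] -->
    q ^+ (`|((fib n.+3)%:Z * r)%R| ^ 2) / qpoch_inf q q by exact: cvg_durfee.
have diff := bsum_tannery q_lt1 id e'_gt0 B0 (fun N r => hB N ((fib n.+3)%:Z * r)) durfee_lim.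
have E_neq0 := qpoch_inf_neq0 q_lt1.
have theta_lim := cvg_theta q_lt1 q_neq0 e_gt0.
have rhsE : rhs q n.+4 = qpoch_inf (q ^+ e) (q ^+ e.*2.+1) * qpoch_inf (q ^+ e.+1) (q ^+ e.*2.+1)
    * qpoch_inf (q ^+ e.*2.+1) (q ^+ e.*2.+1) / qpoch_inf q q + 0.
  rewrite addr0 /rhs.
  have -> : (fib n.+4 * fib n.+4.-1)%N = e.+1 by rewrite /e mulnC prednK // ltnW // mulnC.
  by rewrite (_ : (2 * e.+1).-1 = e.*2.+1) //; lia.
(* The theta sum divided by [(q)_oo], plus an error that tends to 0 by Tannery's theorem; the
   partial sums turn out to equal this sequence. *)
have lim : (bsum N (theta_coef q e) / qpoch_inf q q
    + (bsum N (fun r => theta_coef q e' r * durfee q N ((fib n.+3)%:Z * r))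
      - bsum N (fun r => theta_coef q e' r * (q ^+ (`|((fib n.+3)%:Z * r)%R| ^ 2) / qpoch_inf q q))))
    @[N --> \oo] --> rhs q n.+4.
  rewrite rhsE; apply: cvgD; last exact: diff.
  by apply: cvgM; [exact: theta_lim|exact: cvg_cst].
apply: eq_cvg_from (0 : nat) _ lim => N _.
rewrite lhs_partial_durfee // addrC mulr_bsuml -[RHS]addr0 -addrA; congr (_ + _).
rewrite addrC -bsumB /bsum big1 // => i _.
(* The two theta sums cancel termwise because [e' + F_(k-1)^2 = e]. *)
have z r : theta_coef q e r / qpoch_inf q q
    - theta_coef q e' r * (q ^+ (`|((fib n.+3)%:Z * r)%R| ^ 2) / qpoch_inf q q) = 0.
  rewrite mulrA abszM /= expnMn theta_coefD /e' /e fib_area subrr //.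
by rewrite !z addr0.
Qed.
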